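(* Let $n\ge 1$ and $d\ge 0$ be integers, and for $z\in\mathbf{C}^n$ set $r(z,\overline z)=(1+\|z\|^2)^d$. Let $g(z,\overline z)$ be a nonzero multiple of $r$, i.e. $g(z,\overline z)=r(z,\overline z)\,h(z,\overline z)$ for some polynomial $h$ in $(z,\overline z)$ with complex coefficients, and $g$ is not identically $0$. Then $\mathbf{r}(g)\ge \binom{n+d}{d}$. Moreover, equality is possible: for every $n$ and $d$ there is a nonzero multiple $g$ of $r$ with $\mathbf{r}(g)=\binom{n+d}{d}$. (Here $\binom{n+d}{d}$ equals the dimension of the vector space of polynomials of degree at most $d$ in $n$ variables.)
   Context: For $z=(z_1,\dots,z_n)\in\mathbf{C}^n$ write $\|z\|^2=\sum_{j=1}^n|z_j|^2$. A polynomial in $(z,\overline z)$ is written in multi-index notation as $g(z,\overline z)=\sum_{\alpha,\beta}c_{\alpha,\beta}z^\alpha\overline z^\beta$ (a finite sum with $c_{\alpha,\beta}\in\mathbf{C}$, not required to be real-valued). The rank $\mathbf{r}(g)$ is the rank of the matrix $(c_{\alpha,\beta})$, with rows and columns indexed by multi-indices $\alpha,\beta\in\mathbf{Z}_{\ge0}^n$. *)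

(* Defs.v *)
From mathcomp Require Import all_boot all_order all_algebra.
From mathcomp Require Import reals complex mpoly.

Set Implicit Arguments.
Unset Strict Implicit.
Unset Printing Implicit Defensive.

Import Order.TTheory GRing.Theory Num.Theory.
Local Open Scope ring_scope.

(* A polynomial in (z, conj z), z in C^n, is an element of
   {mpoly R[i][n + n]}: the first n variables stand for z_1, .., z_n and the
   last n for their conjugates. *)
Definition joinf (T : Type) (n : nat) (a b : 'I_n -> T) (k : 'I_(n + n)) : T :=
  match split k with inl j => a j | inr j => b j end.

Definition zzbar_eval (R : realType) (n : nat) (g : {mpoly R[i][n + n]})
  (z : 'I_n -> R[i]) : R[i] := g.@[joinf z (fun j => (z j)^*)].

Definition zzbar_coef (R : realType) (n : nat) (g : {mpoly R[i][n + n]})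
  (alpha beta : 'X_{1..n}) : R[i] :=
  g@_[multinom joinf alpha beta k | k < n + n].

(* The matrix (c_{alpha, beta}) is infinite, but c_{alpha, beta} = 0 as soon as
   |alpha| + |beta| >= msize g, so all its nonzero rows and columns are indexed
   by the finite type of multi-indices of degree < msize g. *)
Definition zzbar_coef_mx (R : realType) (n : nat) (g : {mpoly R[i][n + n]}) :
  'M[R[i]]_#|{: 'X_{1..n < msize g}}| :=
  \matrix_(a, b) zzbar_coef g (bmnm (enum_val a)) (bmnm (enum_val b)).

Definition zzbar_rank (R : realType) (n : nat) (g : {mpoly R[i][n + n]}) : nat :=
  \rank (zzbar_coef_mx g).

Definition sqnorm (R : realType) (n : nat) (z : 'I_n -> R[i]) : R[i] :=
  \sum_(j < n) `|z j| ^+ 2.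

Definition nonzero_multiple (R : realType) (n : nat)
  (r : ('I_n -> R[i]) -> R[i]) (g : {mpoly R[i][n + n]}) : Prop :=
  (exists h : {mpoly R[i][n + n]},
     forall z : 'I_n -> R[i], zzbar_eval g z = r z * zzbar_eval h z) /\
  (exists z : 'I_n -> R[i], zzbar_eval g z <> 0).

(* Main.v *)
Require Import Defs.
From mathcomp Require Import all_boot all_order all_algebra.
From mathcomp Require Import zify ring.
From mathcomp Require Import reals complex mpoly.
Import Order.TTheory GRing.Theory Num.Theory.
Local Open Scope ring_scope.

Set Implicit Arguments.
Unset Strict Implicit.
Unset Printing Implicit Defensive.

(** Polarization turns g = r h into an identity of polynomials in independent
    variables z, w, with r = (1 + sum_j z_j w_j)^d.  Fix a monomial order and
    compare monomials z^a w^b by the formal difference a - b.  All monomials of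
    r have difference 0, so the part g_1 of g of lowest difference is r times
    the lowest part of h.  In the coefficient matrix of g, the monomials of g_1
    are the diagonal entries of a triangular submatrix, hence the rank of g is
    at least the number of monomials of g_1.

    It remains to see that a nonzero multiple p = (1 + sum_j z_j w_j)^d q, with
    j ranging over k indices, has at least C(k+d, d) monomials.  One may assume
    that z_i does not divide q; then setting z_i = 0 gives C(k-1+d, d) monomials
    free of z_i, while dp/dz_i is a nonzero multiple of the (d-1)st power and
    gives C(k+d-1, d-1) monomials containing z_i.

    Equality holds for g = r, whose coefficient matrix is diagonal, with nonzero
    entries only at multi-indices of degree at most d. *)

(** * Polarization: from identities at conjugate points to formal identities *)

Lemma poly_nat_roots_eq0 (K : numDomainType) (p : {poly K}) :
  (forall k : nat, p.[k%:R] = 0) -> p = 0.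
Proof.
move=> hp; apply/eqP/negPn/negP => p0.
have := max_poly_roots p0 (rs := [seq k%:R | k <- iota 0 (size p)]).
rewrite size_map size_iota ltnn => H; suff: false by []; apply: H.
  by apply/allP => _ /mapP[k _ ->]; apply/rootP.
by rewrite map_inj_uniq ?iota_uniq // => a b /eqP; rewrite eqr_nat => /eqP.
Qed.

Lemma mpoly_nat_roots_eq0 (K : numDomainType) (N : nat) (p : {mpoly K[N]}) :
  (forall v : 'I_N -> nat, p.@[fun i => (v i)%:R] = 0) -> p = 0.
Proof.
move=> hp; apply/mpolyP => m0; rewrite mcoeff0.
(* Extract the exponent [m0 i] for one variable [i] of [s] after the other. *)
have H (s : seq 'I_N) (v : 'I_N -> nat) :
    \sum_(m <- msupp p | all (fun j => m j == m0 j) s)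
      p@_m * \prod_i (v i)%:R ^+ m i = 0.
  elim: s v => [|i s IH] v /=; first by rewrite -mevalE hp.
  pose f : {poly K} := \sum_(m <- msupp p | all (fun j => m j == m0 j) s)
      (p@_m * \prod_(j | j != i) (v j)%:R ^+ m j) *: 'X^(m i).
  have f0 : f = 0.
    apply: poly_nat_roots_eq0 => k; rewrite horner_sum.
    rewrite -[RHS](IH (fun j => if j == i then k else v j)).
    apply: eq_bigr => m _; rewrite hornerZ hornerXn [in RHS](bigD1 i) //= eqxx.
    rewrite -mulrA [_ ^+ _ * _]mulrC; congr (_ * (_ * _)).
    by apply: eq_bigr => j /negPf ->.
  have /(congr1 (fun c => c * (v i)%:R ^+ m0 i)) :=
    congr1 (fun h : {poly K} => h`_(m0 i)) f0.
  rewrite coef0 mul0r coef_sum mulr_suml => E.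
  rewrite -[RHS]E big_mkcondl; apply: eq_bigr => m _.
  rewrite coefZ coefXn eq_sym; case: eqP => [->|_]; last by rewrite mulr0 mul0r.
  by rewrite mulr1 -mulrA; congr (_ * _); rewrite [LHS](bigD1 i) //= mulrC.
have := H (enum 'I_N) (fun=> 1%N).
rewrite (eq_bigl (pred1 m0)); last first.
  move=> m; apply/allP/eqP => [h|-> //]; apply/mnmP => i; apply/eqP/h.
  by rewrite mem_enum.
have [m0p|m0p] := boolP (m0 \in msupp p); last first.
  by move=> _; apply/eqP; rewrite mcoeff_eq0.
rewrite -big_filter filter_pred1_uniq // big_seq1.
by rewrite big1 ?mulr1 // => i _; rewrite expr1n.
Qed.

(** Substitute z = x + iy and w = x - iy with independent x, y. The result vanishes at all natural
    x, y, hence formally, and the substitution is invertible over the complex numbers. *)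
Lemma zzbar_eval_eq0 (R : realType) (n : nat) (g : {mpoly R[i][n + n]}) :
  (forall z, zzbar_eval g z = 0) -> g = 0.
Proof.
move=> g0.
pose q := g \mPo [tuple joinf (fun j => 'X_(lshift n j) + 'i *: 'X_(rshift n j))
  (fun j => 'X_(lshift n j) - 'i *: 'X_(rshift n j)) k | k < n + n].
have q0 : q = 0.
  apply: mpoly_nat_roots_eq0 => v; rewrite comp_mpoly_meval.
  rewrite -[RHS](g0 (fun j => (v (lshift n j))%:R + 'i * (v (rshift n j))%:R)).
  apply: meval_eq => k; rewrite tnth_mktuple /joinf; case: split => j.
    by rewrite mevalD mevalZ !mevalXU.
  by rewrite mevalB mevalZ !mevalXU rmorphD rmorphM /= conjCi !conjC_nat mulNr.
apply: mpoly_nat_roots_eq0 => v.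
(* The inverse substitution, x = (z + w) / 2 and y = (z - w) / 2i, at (z, w) = [v]. *)
pose u := joinf (fun j : 'I_n => ((v (lshift n j))%:R + (v (rshift n j))%:R) / 2)
  (fun j => ((v (lshift n j))%:R - (v (rshift n j))%:R) / (2 * 'i)) : _ -> R[i].
have := congr1 (meval u) q0; rewrite meval0 comp_mpoly_meval => <-.
have ul j : u (lshift n j) = ((v (lshift n j))%:R + (v (rshift n j))%:R) / 2.
  by rewrite /u /joinf (unsplitK (inl j : 'I_n + 'I_n)).
have ur j : u (rshift n j) = ((v (lshift n j))%:R - (v (rshift n j))%:R) / (2 * 'i).
  by rewrite /u /joinf (unsplitK (inr j : 'I_n + 'I_n)).
have i0 : 'i != 0 :> R[i] by exact: neq0Ci.
have two : 2 != 0 :> R[i] by rewrite pnatr_eq0.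
apply: meval_eq => k; rewrite tnth_mktuple /joinf.
have -> : k = unsplit (split k) by rewrite splitK.
rewrite unsplitK; case: split => j /=.
  rewrite mevalD mevalZ !mevalXU ul ur /=.
  by field; rewrite i0.
rewrite mevalB mevalZ !mevalXU ul ur /=.
by field; rewrite i0.
Qed.

(** * Counting the monomials of a multiple of (1 + sum_j z_j w_j)^d *)

Lemma msize_mderiv (K : numDomainType) (N : nat) (i : 'I_N) (q : {mpoly K[N]}) :
  q != 0 -> (msize q^`M(i) < msize q)%N.
Proof.
move=> q0; rewrite -msize_poly_eq0 -lt0n in q0.
rewrite -(prednK q0) ltnS.
rewrite mmeasureE; apply/bigmax_leqP_seq => m.
rewrite mcoeff_msupp mcoeff_mderiv mulrn_eq0 /= -mcoeff_msupp => /msize_mdeg_lt.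
rewrite mdegD mdeg1 addn1 => hm _; by rewrite -ltnS (prednK q0).
Qed.

(* Differentiating the equation replaces (d, q) by (d + 1, q'), and q' has
   smaller size. *)
Lemma mderiv_ode_eq0 (K : numDomainType) (N : nat) (i : 'I_N)
    (L q : {mpoly K[N]}) (d : nat) : L^`M(i) != 0 -> L^`M(i)^`M(i) = 0 ->
  L^`M(i) * q *+ d.+1 + L * q^`M(i) = 0 -> q = 0.
Proof.
move=> L1 L2; elim: {q}(msize q) {-2}q (leqnn (msize q)) d => [|k IH] q.
  by rewrite leqn0 msize_poly_eq0 => /eqP.
move=> hq d E; apply/eqP/negPn/negP => q0.
have D0 : q^`M(i) = 0.
  apply: (IH _ _ d.+1); first by rewrite -ltnS (leq_trans (msize_mderiv i q0)).
  have := congr1 (mderiv i) E.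
  rewrite raddf0 mderivD mderivMn !mderivM L2 mul0r add0r => <-.
  by rewrite addrA -mulrSr.
(* With q' = 0 the equation reads (d + 1) L' q = 0, which forces q = 0 in characteristic 0. *)
move: E; rewrite D0 mulr0 addr0 => /eqP.
rewrite -mulr_natl !mulf_eq0 (negPf L1) (negPf q0) !orbF.
by rewrite -(rmorph_nat (mpolyC N (R := K))) mpolyC_eq0 pnatr_eq0.
Qed.

(** Multiplication by ['X_i] embeds the support of the derivative into the monomials of [p] that
    contain ['X_i]. *)
Lemma size_msupp_mderiv (K : numDomainType) (N : nat) (i : 'I_N)
    (p : {mpoly K[N]}) :
  (size (msupp p^`M(i)) <= count (fun m : 'X_{1..N} => m i != 0%N) (msupp p))%N.
Proof.
rewrite -size_filter -(size_map (fun m => m + U_(i))%MM).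
apply: uniq_leq_size => [|_ /mapP[m hm ->]].
  by rewrite map_inj_uniq ?msupp_uniq //; apply: addIm.
rewrite mem_filter mnmDE mnm1E eqxx addn1 /=.
by move: hm; rewrite !mcoeff_msupp mcoeff_mderiv mulrn_eq0.
Qed.

Definition msubst0 (K : numDomainType) (N : nat) (i : 'I_N) (p : {mpoly K[N]}) :=
  p \mPo [tuple (if j == i then 0 else 'X_j) | j < N].

Lemma mcoeff_msubst0 (K : numDomainType) (N : nat) (i : 'I_N)
  (p : {mpoly K[N]}) (m : 'X_{1..N}) :
  (msubst0 i p)@_m = if m i == 0%N then p@_m else 0.
Proof.
rewrite /msubst0 {2}[p]mpolyE comp_mpolyEX !raddf_sum /=.
rewrite [RHS](_ : _ = \sum_(m0 <- msupp p)
  if m i == 0%N then (p@_m0 *: 'X_[m0])@_m else 0); last first.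
  by case: ifP => // _; rewrite big1.
apply: eq_bigr => m0 _; rewrite comp_mpolyX !mcoeffZ.
have [m0i|m0i] := eqVneq (m0 i) 0%N.
  have -> : \prod_(j < N) tnth [tuple (if j == i then 0 else 'X_j) | j < N] j ^+ m0 j
     = 'X_[m0] :> {mpoly K[N]}.
    rewrite [RHS]mpolyXE_id; apply: eq_bigr => j _; rewrite tnth_mktuple.
    by case: eqVneq => [->|//]; rewrite m0i !expr0.
  rewrite mcoeffX; case: eqVneq => [<-|_]; first by rewrite m0i.
  by rewrite mulr0 if_same.
rewrite (bigD1 i) //= tnth_mktuple eqxx expr0n (negPf m0i) mul0r mcoeff0 mulr0.
rewrite mcoeffX; case: (m0 =P m) => [<-|_]; first by rewrite (negPf m0i).
by rewrite mulr0 if_same.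
Qed.

Lemma size_msupp_msubst0 (K : numDomainType) (N : nat) (i : 'I_N)
    (p : {mpoly K[N]}) :
  (size (msupp (msubst0 i p)) <= count (fun m : 'X_{1..N} => m i == 0%N) (msupp p))%N.
Proof.
rewrite -size_filter; apply: uniq_leq_size => [|m]; first exact: msupp_uniq.
rewrite mem_filter !mcoeff_msupp mcoeff_msubst0; case: ifP => //.
by rewrite eqxx.
Qed.

Lemma msubst0_eq0 (K : numDomainType) (N : nat) (i : 'I_N) (p : {mpoly K[N]}) :
  msubst0 i p = 0 -> exists q, p = q * 'X_i.
Proof.
move=> p0; exists (\sum_(m <- msupp p) p@_m *: 'X_[m - U_(i)]).
rewrite {1}[p]mpolyE mulr_suml; apply: eq_big_seq => m hm.
rewrite -scalerAl -mpolyXD submK //; apply/mnm_lepP => j; rewrite mnm1E.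
case: eqVneq => [<-|//] /=; rewrite lt0n; apply/negP => mi.
by move: hm; rewrite mcoeff_msupp; have := mcoeff_msubst0 i p m;
  rewrite p0 mcoeff0 mi => <-; rewrite eqxx.
Qed.

Definition sqnorm1_poly (K : numDomainType) (n : nat) (s : seq 'I_n) :
    {mpoly K[n + n]} :=
  1 + \sum_(j <- s) 'X_(lshift n j) * 'X_(rshift n j).

(** Three nested inductions, on [s], on [d] and on the size of [q]; the innermost one divides [q] by
    z_i as long as [q] vanishes at z_i = 0. *)
Lemma size_msupp_multiple (K : numDomainType) (n d : nat) (s : seq 'I_n)
    (q : {mpoly K[n + n]}) : uniq s -> q != 0 ->
  ('C(size s + d, d) <= size (msupp (sqnorm1_poly K s ^+ d * q)))%N.
Proof.
have pos (p : {mpoly K[n + n]}) : p != 0 -> (0 < size (msupp p))%N.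
  by rewrite lt0n size_eq0 msupp_eq0.
elim: s d q => [|i s IHs] d q us q0.
  by rewrite add0n binn /sqnorm1_poly big_nil addr0 expr1n mul1r pos.
elim: d q q0 => [|d IHd] q q0; first by rewrite bin0 expr0 mul1r pos.
case/andP: us => /= nis us.
elim: {q}(msize q) {-2}q (leqnn (msize q)) q0 => [|k IH] q hq q0.
  by move: hq; rewrite leqn0 msize_poly_eq0 (negPf q0).
have [s0|s0] := eqVneq (msubst0 (lshift n i) q) 0.
  have [q' Eq] := msubst0_eq0 s0.
  have q'0 : q' != 0 by apply: contraNneq q0 => E; rewrite Eq E mul0r.
  rewrite Eq mulrA (perm_size (msuppMX _ _)) size_map IH //.
  move: hq; rewrite Eq msizeM //; last by rewrite -msupp_eq0 msuppX.
  by rewrite msizeX mdeg1 addnS addn1.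
have dX (j l : 'I_(n + n)) : ('X_l : {mpoly K[n + n]})^`M(j) = (l == j)%:R.
  rewrite mderivX mnm1E; case: eqP => [->|_]; last by rewrite scale0r.
  suff -> : (U_(j) - U_(j) = 0)%MM by rewrite mpolyX0 scale1r.
  by apply/mnmP => k'; rewrite mnmBE subnn mnm0E.
have rl (j l : 'I_n) : (rshift n j == lshift n l) = false.
  by rewrite eq_sym; exact: eq_lrshift.
have ll (j l : 'I_n) : (lshift n j == lshift n l) = (j == l).
  exact: eq_lshift.
have sX (j l : 'I_(n + n)) : msubst0 j ('X_l : {mpoly K[n + n]}) =
    if l == j then 0 else 'X_l.
  by rewrite /msubst0 comp_mpolyXU -tnth_nth tnth_mktuple.
have his t : sqnorm1_poly K (i :: t) =
    sqnorm1_poly K t + 'X_(lshift n i) * 'X_(rshift n i).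
  by rewrite /sqnorm1_poly big_cons addrCA addrC.
set L := sqnorm1_poly K (i :: s); set p := L ^+ d.+1 * q.
have hs : (forall j, j \in s -> (j == i) = false).
  by move=> j js; apply: negbTE; apply: contraNneq nis => <-.
have dL : L^`M(lshift n i) = 'X_(rshift n i).
  rewrite /L his /sqnorm1_poly !mderivD mderivM !dX eqxx rl mul1r mulr0 addr0.
  rewrite -[X in X^`M(_)](rmorph1 (mpolyC _ (R := K))) mderivC add0r.
  rewrite raddf_sum big1_seq ?add0r // => j /andP[_ js].
  by rewrite /= mderivM !dX ll rl (hs _ js) mul0r mulr0 addr0.
have sL : msubst0 (lshift n i) L = sqnorm1_poly K s.
  rewrite /msubst0 /L his rmorphD rmorphM /= -!/(msubst0 _ _) !sX eqxx mul0r addr0.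
  rewrite /msubst0 /sqnorm1_poly rmorphD rmorph1 rmorph_sum; congr (_ + _).
  apply: eq_big_seq => j js.
  by rewrite rmorphM /= -!/(msubst0 _ _) !sX ll rl (hs _ js).
(* Pascal's rule, matched with the split of the monomials of [p] into those free of z_i and those
   containing it. *)
rewrite addSn binS -(count_predC (fun m : 'X_{1..n + n} => m (lshift n i) == 0%N)).
apply: leq_add.
  apply: leq_trans (size_msupp_msubst0 _ _).
  rewrite /p /msubst0 rmorphM rmorphXn /= -!/(msubst0 _ _) sL.
  exact: IHs.
apply: leq_trans (size_msupp_mderiv _ _).
have -> : p^`M(lshift n i) =
    L ^+ d * (L^`M(lshift n i) * q *+ d.+1 + L * q^`M(lshift n i)).
  rewrite /p mderivM.
  have -> : (L ^+ d.+1)^`M(lshift n i) = L ^+ d * L^`M(lshift n i) *+ d.+1.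
    elim: {p}d {IHd IH} => [|e IHe]; first by rewrite expr1 expr0 mul1r.
    by rewrite exprS mderivM IHe mulrnAr mulrA -exprS mulrC -mulrS.
  by rewrite mulrDr mulrnAr mulrA mulrnAl [L ^+ d.+1]exprSr mulrA.
(* The cofactor of [L ^+ d] is nonzero by [mderiv_ode_eq0], as [L] has degree 1 in z_i. *)
rewrite -addSnnS; apply: IHd.
apply: contra_neq q0; apply: mderiv_ode_eq0.
  by rewrite dL -msupp_eq0 msuppX.
by rewrite dL dX rl.
Qed.

(** * Rank estimates for matrices *)

Lemma triangular_row_free (F : fieldType) (s : nat) (disp : Order.disp_t)
    (T : orderType disp) (key : 'I_s -> T) (M : 'M[F]_s) :
  injective key -> (forall a, M a a != 0) ->
  (forall a b, M a b != 0 -> (key b <= key a)%O) -> row_free M.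
Proof.
move=> inj diag tri; apply: inj_row_free => v vM.
apply/rowP => b; rewrite mxE; apply/eqP/negPn/negP => vb.
(* Among the rows with a nonzero coefficient in the vanishing combination, take the one of greatest
   key: in column [c] only its diagonal term survives. *)
have [c vc cmax] := @arg_maxP _ _ _ b (fun b => v 0 b != 0) key vb.
have := congr1 (fun w : 'rV_s => w 0 c) vM; rewrite !mxE (bigD1 c) //= big1.
  by move/eqP; rewrite addr0 mulf_eq0 (negPf vc) (negPf (diag c)).
move=> a ac; apply/eqP/negPn/negP; rewrite mulf_eq0 negb_or => /andP[va Mac].
have kac : (key a <= key c)%O by exact: cmax.
by case/negP: ac; apply/eqP/inj/le_anti; rewrite kac (tri _ _ Mac).
Qed.

Lemma mxrank_mxsub (F : fieldType) (m n p q : nat) (f : 'I_p -> 'I_m)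
    (g : 'I_q -> 'I_n) (A : 'M[F]_(m, n)) : (\rank (mxsub f g A) <= \rank A)%N.
Proof.
rewrite -[A in mxsub _ _ A]mulmx1 mxsub_mul rowsubE.
exact: leq_trans (mxrankM_maxl _ _) (mxrankM_maxr _ _).
Qed.

(** [A] factors through its [#|D|] rows indexed by [D]. *)
Lemma mxrank_le_nz_rows (F : fieldType) (m n : nat) (D : {set 'I_m})
    (A : 'M[F]_(m, n)) : (forall i j, A i j != 0 -> i \in D) ->
  (\rank A <= #|D|)%N.
Proof.
move=> hD.
pose B : 'M[F]_(m, #|D|) := \matrix_(i, k) (i == enum_val k)%:R.
suff -> : A = B *m rowsub enum_val A by exact: mulmx_max_rank.
apply/matrixP => i j; rewrite mxE.
have [iD|iD] := boolP (i \in D).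
  rewrite (bigD1 (enum_rank_in iD i)) //= big1 => [|k kn]; rewrite !mxE.
    by rewrite enum_rankK_in // eqxx mul1r addr0.
  case: (i =P enum_val k) kn => [E|_ _]; last by rewrite mul0r.
  by case/eqP; apply: enum_val_inj; rewrite enum_rankK_in.
have -> : A i j = 0 by apply/eqP; apply: contraNT iD; exact: hD.
rewrite big1 // => k _; rewrite !mxE.
case: (i =P enum_val k) => [E|_]; last by rewrite mul0r.
by rewrite E enum_valP in iD.
Qed.

(** * Splitting exponents into their z and conjugate halves *)

Definition lmon (n : nat) (m : 'X_{1..n + n}) : 'X_{1..n} :=
  [multinom m (lshift n j) | j < n].
Definition rmon (n : nat) (m : 'X_{1..n + n}) : 'X_{1..n} :=
  [multinom m (rshift n j) | j < n].

Lemma lmon0 n : lmon (0 : 'X_{1..n + n}) = 0%MM.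
Proof. by apply/mnmP => j; rewrite !mnmE. Qed.

Lemma rmon0 n : rmon (0 : 'X_{1..n + n}) = 0%MM.
Proof. by apply/mnmP => j; rewrite !mnmE. Qed.

Lemma lmonD n (m m' : 'X_{1..n + n}) : lmon (m + m') = (lmon m + lmon m')%MM.
Proof. by apply/mnmP => j; rewrite mnmDE !mnmE. Qed.

Lemma rmonD n (m m' : 'X_{1..n + n}) : rmon (m + m') = (rmon m + rmon m')%MM.
Proof. by apply/mnmP => j; rewrite mnmDE !mnmE. Qed.

Lemma mdeg_lrmon n (m : 'X_{1..n + n}) : mdeg m = (mdeg (lmon m) + mdeg (rmon m))%N.
Proof.
rewrite !mdegE big_split_ord.
by congr (_ + _)%N; apply: eq_bigr => j _; rewrite mnmE.
Qed.

Definition jmon (n : nat) (a b : 'X_{1..n}) : 'X_{1..n + n} :=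
  [multinom joinf a b k | k < n + n].

Lemma lmon_jmon n (a b : 'X_{1..n}) : lmon (jmon a b) = a.
Proof.
by apply/mnmP => j; rewrite !mnmE /joinf (unsplitK (inl j : 'I_n + 'I_n)).
Qed.

Lemma rmon_jmon n (a b : 'X_{1..n}) : rmon (jmon a b) = b.
Proof.
by apply/mnmP => j; rewrite !mnmE /joinf (unsplitK (inr j : 'I_n + 'I_n)).
Qed.

Lemma jmonK n (m : 'X_{1..n + n}) : jmon (lmon m) (rmon m) = m.
Proof.
by apply/mnmP => k; rewrite mnmE /joinf -{2}[k]splitK; case: split => j;
  rewrite mnmE.
Qed.

(* Minimality of [lmon m0 - rmon m0], written without subtraction. *)
Lemma exists_min_monomial n (s : seq 'X_{1..n + n}) : s != [::] ->
  exists2 m0, m0 \in s &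
    forall m, m \in s -> ((lmon m0 + rmon m)%MM <= (lmon m + rmon m0)%MM)%O.
Proof.
elim: s => // m1 [|m2 s] IH _.
  by exists m1; rewrite ?inE // => m; rewrite inE => /eqP ->.
have [//|m0 m0s hm0] := IH.
have [le|/ltW le] := leP (lmon m0 + rmon m1)%MM (lmon m1 + rmon m0)%MM.
  exists m0; first by rewrite inE m0s orbT.
  by move=> m; rewrite inE => /predU1P[->|/hm0].
exists m1; first by rewrite inE eqxx.
move=> m; rewrite inE => /predU1P[->//|/hm0 le'].
(* Transitivity of the comparison of differences: add the two inequalities and cancel
   [lmon m0 + rmon m0]. *)
have := lem_add le le'.
have -> : (lmon m1 + rmon m0 + (lmon m0 + rmon m) =
  lmon m0 + rmon m0 + (lmon m1 + rmon m))%MM.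
  by apply/mnmP => j; rewrite !mnmDE; lia.
have -> : (lmon m0 + rmon m1 + (lmon m + rmon m0) =
  lmon m0 + rmon m0 + (lmon m + rmon m1))%MM.
  by apply/mnmP => j; rewrite !mnmDE; lia.
by rewrite lemc_add2r.
Qed.

(** The equality of the halves makes multiplication by r preserve differences; the degree bound
    limits the nonzero rows in the equality case. *)
Lemma msupp_sqnorm1_poly_exp (K : numDomainType) (n d : nat) (s : seq 'I_n)
    (m : 'X_{1..n + n}) : m \in msupp (sqnorm1_poly K s ^+ d) ->
  lmon m = rmon m /\ (mdeg (lmon m) <= d)%N.
Proof.
elim: d m => [|d IH] m.
  rewrite expr0 -[1](rmorph1 (mpolyC _ (R := K))) msuppC oner_eq0 inE => /eqP ->.
  by rewrite lmon0 rmon0 mdeg0.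
rewrite exprS => /msuppM_le /allpairsP[[m1 m2] /= [h1 /IH[E le] ->]].
rewrite lmonD rmonD E mdegD -E.
suff [-> le1] : lmon m1 = rmon m1 /\ (mdeg (lmon m1) <= 1)%N.
  by split=> //; rewrite -add1n leq_add.
move: h1; rewrite /sqnorm1_poly => /msuppD_le; rewrite mem_cat => /orP[|].
  rewrite -[1](rmorph1 (mpolyC _ (R := K))) msuppC oner_eq0 inE => /eqP ->.
  by rewrite lmon0 rmon0 mdeg0.
move/msupp_sum_le/flattenP => [_ /mapP[j _ ->]].
rewrite -mpolyXD msuppX inE => /eqP ->.
have -> : lmon (U_(lshift n j) + U_(rshift n j)) = U_(j)%MM.
  apply/mnmP => k; rewrite mnmE mnmDE !mnm1E eq_lshift.
  by rewrite [rshift _ _ == _]eq_sym eq_lrshift addn0.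
have -> : rmon (U_(lshift n j) + U_(rshift n j)) = U_(j)%MM.
  by apply/mnmP => k; rewrite mnmE mnmDE !mnm1E eq_rshift eq_lrshift add0n.
by rewrite mdeg1.
Qed.

(** * The lower bound for the rank *)

Lemma zzbar_rank_multiple_ge (R : realType) (n d : nat) (h : {mpoly R[i][n + n]}) :
  h != 0 ->
  ('C(n + d, d) <= zzbar_rank (sqnorm1_poly _ (enum 'I_n) ^+ d * h))%N.
Proof.
move=> h0; have addmCA (a b c : 'X_{1..n}) : (a + (b + c) = b + (a + c))%MM.
  by rewrite !addmA [(a + b)%MM]addmC.
set L := sqnorm1_poly _ _ ^+ d; set g := L * h.
have [|m0 m0h m0min] := @exists_min_monomial n (msupp h).
  by rewrite msupp_eq0.
(* [P] selects the lowest difference, so [h1] is the lowest part of [h]. *)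
pose P m := (lmon m0 + rmon m == lmon m + rmon m0)%MM.
pose h1 := \sum_(m <- msupp h | P m) h@_m *: 'X_[m].
pose h2 := \sum_(m <- msupp h | ~~ P m) h@_m *: 'X_[m].
have hE : h = h1 + h2 by rewrite {1}[h]mpolyE (bigID P).
have sub (Q : pred 'X_{1..n + n}) m :
    m \in msupp (\sum_(m <- msupp h | Q m) h@_m *: 'X_[m]) -> m \in msupp h /\ Q m.
  move/msupp_sum_le/flattenP => [_ /mapP[m' + ->]]; rewrite mem_filter => /andP[Qm m'h].
  by move/msuppZ_le; rewrite msuppX inE => /eqP ->.
have h10 : h1 != 0.
  apply: contraTneq m0h => h10.
  rewrite mcoeff_msupp hE h10 add0r -mcoeff_msupp.
  by apply/negP => /sub[_]; rewrite /P eqxx.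
have g1 m : m \in msupp (L * h1) -> P m.
  move=> /msuppM_le/allpairsP[[l k] /=].
  case=> [/msupp_sqnorm1_poly_exp[E _] /sub[_ /eqP Pk] ->].
  apply/eqP; rewrite lmonD rmonD -E.
  by rewrite addmCA Pk addmA.
have g2 m : m \in msupp (L * h2) -> ((lmon m0 + rmon m)%MM < (lmon m + rmon m0)%MM)%O.
  move=> /msuppM_le/allpairsP[[l k] /=].
  case=> [/msupp_sqnorm1_poly_exp[E _] /sub[kh Pk] ->].
  rewrite lmonD rmonD -E addmCA -addmA ltmc_add2r lt_neqAle Pk.
  exact: m0min.
have gle m : m \in msupp g -> ((lmon m0 + rmon m)%MM <= (lmon m + rmon m0)%MM)%O.
  rewrite /g hE mulrDr => /msuppD_le; rewrite mem_cat => /orP[/g1/eqP->//|/g2].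
  exact: ltW.
(* No cancellation: the monomials of [L * h2] have strictly larger difference. *)
have gS m : m \in msupp (L * h1) -> m \in msupp g.
  move=> m1; rewrite mcoeff_msupp /g hE mulrDr mcoeffD.
  have -> : (L * h2)@_m = 0.
    apply/eqP; rewrite mcoeff_eq0; apply/negP => /g2.
    by rewrite (eqP (g1 _ m1)) ltxx.
  by rewrite addr0 -mcoeff_msupp.
have := @size_msupp_multiple _ n d (enum 'I_n) h1 (enum_uniq _) h10.
rewrite size_enum_ord => /leq_trans; apply; rewrite -/L.
set S := msupp (L * h1).
pose mon (a : 'I_(size S)) := nth 0%MM S a.
have monS a : mon a \in S by apply: mem_nth.
have ldeg a : (mdeg (lmon (mon a)) < msize g)%N.
  apply: leq_ltn_trans (msize_mdeg_lt (gS _ (monS a))).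
  by rewrite [leqRHS]mdeg_lrmon leq_addr.
have rdeg a : (mdeg (rmon (mon a)) < msize g)%N.
  apply: leq_ltn_trans (msize_mdeg_lt (gS _ (monS a))).
  by rewrite [leqRHS]mdeg_lrmon leq_addl.
(* Rows are indexed by the z halves and columns by the conjugate halves of the monomials in [S], so
   that the diagonal carries the coefficients of [g] on [S]. *)
pose M := mxsub (fun a => enum_rank (BMultinom (ldeg a)))
  (fun a => enum_rank (BMultinom (rdeg a))) (zzbar_coef_mx g).
have ME a b : M a b = g@_(jmon (lmon (mon a)) (rmon (mon b))).
  by rewrite !mxE !enum_rankK /=.
suff Mfree : row_free M.
  rewrite -row_leq_rank in Mfree.
  by apply: leq_trans Mfree _; exact: mxrank_mxsub.
(* On [S] the difference is constant, so the conjugate half determines the monomial, and minimality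
   of the difference over [g] becomes triangularity. *)
apply: (@triangular_row_free _ _ _ _ (fun a => rmon (mon a))).
- move=> a b E; apply/val_inj/eqP.
  rewrite -(nth_uniq 0%MM (ltn_ord a) (ltn_ord b) (msupp_uniq _)) -!/(mon _).
  have := eqP (g1 _ (monS a)); rewrite E (eqP (g1 _ (monS b))) => /addIm El.
  by rewrite -[mon a]jmonK -[mon b]jmonK E El.
- by move=> a; rewrite ME jmonK -mcoeff_msupp gS.
move=> a b; rewrite ME -mcoeff_msupp => /gle.
by rewrite lmon_jmon rmon_jmon -(eqP (g1 _ (monS a))) lemc_add2r.
Qed.

(** * The equality case and the conclusion *)

Lemma card_bmultinom_le (n d N : nat) :
  (#|[set i : 'I_#|{: 'X_{1..n < N}}| | mdeg (bmnm (enum_val i)) <= d]|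
    <= 'C(n + d, d))%N.
Proof.
rewrite -bin_sub ?leq_addl // addnK -card_partial_ord_partitions.
set D := [set i | _].
(* Encodes multi-indices as tuples of sum at most [d]. On [D] every exponent is at most [d], so
   [inord] never takes its default value and [f] is injective there. *)
pose f (i : 'I_#|{: 'X_{1..n < N}}|) : n.-tuple 'I_d.+1 :=
  [tuple inord (bmnm (enum_val i) j) | j < n].
have fE i (j : 'I_n) : i \in D -> tnth (f i) j = bmnm (enum_val i) j :> nat.
  rewrite inE => le; rewrite tnth_mktuple inordK // ltnS (leq_trans _ le) //.
  by rewrite mdegE (bigD1 j) //= leq_addr.
rewrite -(@card_in_imset _ _ f D); last first.
  move=> i k iD kD E; apply/enum_val_inj/val_inj/mnmP => j /=.
  by rewrite -!fE // E.
apply/subset_leq_card/subsetP => _ /imsetP[i iD ->].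
rewrite inE big_tuple (eq_bigr (fun j => bmnm (enum_val i) j)) => [|j _].

  by rewrite -mdegE; move: iD; rewrite inE.
exact: fE.
Qed.

Lemma zzbar_rank_sqnorm1_poly_exp (R : realType) (n d : nat) (s : seq 'I_n) :
  (zzbar_rank (sqnorm1_poly R[i] s ^+ d) <= 'C(n + d, d))%N.
Proof.
apply: leq_trans (card_bmultinom_le n d _).
apply: mxrank_le_nz_rows => i j; rewrite mxE -mcoeff_msupp.
by case/msupp_sqnorm1_poly_exp => _; rewrite lmon_jmon inE.
Qed.

Lemma zzbar_eval_sqnorm1_poly_exp (R : realType) (n d : nat) (z : 'I_n -> R[i]) :
  zzbar_eval (sqnorm1_poly _ (enum 'I_n) ^+ d) z = (1 + sqnorm z) ^+ d.
Proof.
rewrite /zzbar_eval rmorphXn /= mevalD meval1 raddf_sum big_enum.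
congr ((_ + _) ^+ _); apply: eq_bigr => j _ /=.
rewrite mevalM !mevalXU normCK /joinf.
by rewrite (unsplitK (inl j : 'I_n + 'I_n)) (unsplitK (inr j : 'I_n + 'I_n)).
Qed.

Theorem theorem1p1 (R : realType) (n d : nat) (hn : (0 < n)%N) :
  (forall g : {mpoly R[i][n + n]},
     nonzero_multiple (fun z : 'I_n -> R[i] => (1 + sqnorm z) ^+ d) g ->
     ('C(n + d, d) <= zzbar_rank g)%N) /\
  (exists g : {mpoly R[i][n + n]},
     nonzero_multiple (fun z : 'I_n -> R[i] => (1 + sqnorm z) ^+ d) g /\
     zzbar_rank g = 'C(n + d, d)).
Proof.
split=> [g [[h gh] [z0 gz0]]|].
  (* The two sides agree at all conjugate pairs, hence as formal polynomials. *)
  have -> : g = sqnorm1_poly _ (enum 'I_n) ^+ d * h.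
    apply/eqP; rewrite -subr_eq0; apply/eqP/zzbar_eval_eq0 => z.
    rewrite /zzbar_eval mevalB mevalM -!/(zzbar_eval _ _).
    rewrite zzbar_eval_sqnorm1_poly_exp gh.
    exact: subrr.
  apply: zzbar_rank_multiple_ge; apply/eqP => h0; apply: gz0.
  by rewrite gh h0 /zzbar_eval meval0 mulr0.
exists (sqnorm1_poly _ (enum 'I_n) ^+ d); split.
  split.
    by exists 1 => z; rewrite zzbar_eval_sqnorm1_poly_exp /zzbar_eval meval1 mulr1.
  (* At the origin r equals 1. *)
  exists (fun=> 0); rewrite zzbar_eval_sqnorm1_poly_exp /sqnorm big1 => [|j _].
    by rewrite addr0 expr1n; apply/eqP; exact: oner_neq0.
  by rewrite normr0 expr0n.
apply/anti_leq; rewrite zzbar_rank_sqnorm1_poly_exp /=.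
by rewrite -[sqnorm1_poly _ _ ^+ _]mulr1 zzbar_rank_multiple_ge ?oner_neq0.
Qed.
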